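(* Let $\mathcal{F}$ be a free filter on $\mathbb{N}$. (a) If $\mathcal{F}$ is both a rapid$^+$ filter and a weak P$^+$-filter, then $\mathcal{F}$ is a stationary Fréchet-UBP-filter. (b) If $\mathcal{F}$ is both a rapid$^+$ filter and a P$^+$-filter, then $\mathcal{F}$ is a Fréchet-UBP-filter.
   Context: $\mathbb{N}=\{0,1,2,\ldots\}$. A filter on $\mathbb{N}$ is a non-empty, upwards closed family $\mathcal{F}\subsetneq P(\mathbb{N})$ closed under finite intersections; it is free if it contains all cofinite subsets of $\mathbb{N}$. A set $A\subseteq\mathbb{N}$ is $\mathcal{F}$-stationary if $\mathbb{N}\setminus A\notin\mathcal{F}$. $(\forall_{\mathcal{F}}\, i\in\mathbb{N})\,\Phi(i)$ means $\{i\in\mathbb{N}:\Phi(i)\}\in\mathcal{F}$. $A\subseteq^* B$ means $A\setminus B$ is finite. For infinite $A\subseteq\mathbb{N}$, $\eta_A:\mathbb{N}\to A$ is the unique strictly increasing surjection. $\mathcal{F}$ is a weak P$^+$-filter if for every decreasing sequence $(A_k)_k$ of sets in $\mathcal{F}$ and every $\mathcal{F}$-stationary set $I$ there is an $\mathcal{F}$-stationary set $B\subseteq I$ with $B\subseteq^* A_k$ for every $k$. $\mathcal{F}$ is a P$^+$-filter if for every decreasing sequence $(A_k)_k$ of $\mathcal{F}$-stationary sets there is an $\mathcal{F}$-stationary set $B$ with $B\subseteq^* A_k$ for every $k$. $\mathcal{F}$ is a rapid$^+$ filter if for every $\mathcal{F}$-stationary set $I$ and every strictly increasing $f:\mathbb{N}\to\mathbb{N}$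 there is an $\mathcal{F}$-stationary set $B\subseteq I$ with $f(n)\le\eta_B(n)$ for all $n$. For topological vector spaces $X,Y$, $\mathcal{L}(X,Y)$ is the space of continuous linear maps. A sequence $(y_i)_i$ in $Y$ is $\mathcal{F}$-bounded if for every $0$-neighbourhood $V$ in $Y$ there is $t>0$ with $ty_i\in V$ $(\forall_{\mathcal{F}}\, i\in\mathbb{N})$. A sequence $(T_i)_i$ in $\mathcal{L}(X,Y)$ is pointwise $\mathcal{F}$-bounded if $(T_i(x))_i$ is $\mathcal{F}$-bounded for every $x\in X$. It is $\mathcal{F}$-equicontinuous if for every $0$-neighbourhood $V$ in $Y$ there is a $0$-neighbourhood $U$ in $X$ with $T_i[U]\subseteq V$ $(\forall_{\mathcal{F}}\, i\in\mathbb{N})$. It is $\mathcal{F}$-stationary-equicontinuous if for every $\mathcal{F}$-stationary set $I$ and every $0$-neighbourhood $V$ in $Y$ there are a $0$-neighbourhood $U$ in $X$ and an $\mathcal{F}$-stationary set $J\subseteq I$ with $T_i[U]\subseteq V$ for all $i\in J$. $\mathcal{F}$ is a Fréchet-UBP-filter (resp. stationary Fréchet-UBP-filter) if for every Fréchet space $X$ and every locally convex space $Y$, every pointwise $\mathcal{F}$-bounded sequence in $\mathcal{L}(X,Y)$ is $\mathcal{F}$-equicontinuous (resp. $\mathcal{F}$-stationary-equicontinuous). *)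

(* Defs.v *)
From HB Require Import structures.
From mathcomp Require Import all_boot all_order all_algebra.
From mathcomp Require Import all_classical all_reals all_analysis.
From mathcomp Require Import complex.

Set Implicit Arguments.
Unset Strict Implicit.
Unset Printing Implicit Defensive.

Import Order.TTheory GRing.Theory Num.Theory.
Import numFieldNormedType.Exports.

Local Open Scope classical_set_scope.
Local Open Scope ring_scope.

Definition free_filter (F : set_system nat) : Prop :=
  ProperFilter F /\ (forall A : set nat, finite_set (~` A) -> F A).

Definition stationary (F : set_system nat) (A : set nat) : Prop := ~ F (~` A).

Definition almost_subset (A B : set nat) : Prop := finite_set (A `\` B).

Definition strictly_increasing (f : nat -> nat) : Prop :=
  {homo f : m n / (m < n)%N}.

Definition decreasing_sets (A : nat -> set nat) : Prop :=
  forall k, A k.+1 `<=` A k.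

(* [eta] is the (unique) increasing enumeration of the infinite set [A]. *)
Definition enumerates (eta : nat -> nat) (A : set nat) : Prop :=
  strictly_increasing eta /\ range eta = A.

Definition weak_P_plus (F : set_system nat) : Prop :=
  forall A : nat -> set nat,
    decreasing_sets A -> (forall k, F (A k)) ->
  forall I : set nat, stationary F I ->
  exists B : set nat,
    [/\ stationary F B, B `<=` I & forall k, almost_subset B (A k)].

Definition P_plus (F : set_system nat) : Prop :=
  forall A : nat -> set nat,
    decreasing_sets A -> (forall k, stationary F (A k)) ->
  exists B : set nat, stationary F B /\ (forall k, almost_subset B (A k)).

Definition rapid_plus (F : set_system nat) : Prop :=
  forall I : set nat, stationary F I ->
  forall f : nat -> nat, strictly_increasing f ->
  exists (B : set nat) (eta : nat -> nat),
    [/\ stationary F B, B `<=` I, enumerates eta B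
      & forall n, (f n <= eta n)%N].

Section LinearMaps.
Variables (K : numFieldType) (X Y : topologicalLmodType K).

(* In [K = R[i]] the order satisfies [0 < t] only when [t] is a positive
   real. *)
Definition F_bounded (F : set_system nat) (y : nat -> Y) : Prop :=
  forall V : set Y, nbhs (0 : Y) V ->
  exists2 t : K, 0 < t & F [set i | V (t *: y i)].

Definition pointwise_F_bounded
    (F : set_system nat) (T : nat -> {linear X -> Y}) : Prop :=
  forall x : X, F_bounded F (fun i => T i x).

Definition F_equicontinuous
    (F : set_system nat) (T : nat -> {linear X -> Y}) : Prop :=
  forall V : set Y, nbhs (0 : Y) V ->
  exists2 U : set X, nbhs (0 : X) U & F [set i | T i @` U `<=` V].

Definition F_stationary_equicontinuous
    (F : set_system nat) (T : nat -> {linear X -> Y}) : Prop :=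
  forall I : set nat, stationary F I ->
  forall V : set Y, nbhs (0 : Y) V ->
  exists (U : set X) (J : set nat),
    [/\ nbhs (0 : X) U, stationary F J, J `<=` I
      & forall i, J i -> T i @` U `<=` V].

End LinearMaps.

(* A [tvsType] is locally convex, but the uniform structure it carries is only
   required to induce the topology, not to be translation invariant.  Hence
   completeness is not expressed with that uniform structure: a Fréchet space is
   a locally convex space whose topology is induced by a complete
   translation-invariant metric. *)
Definition Frechet_space
    (R : realType) (K : numFieldType) (X : tvsType K) : Prop :=
  exists d : X -> X -> R,
    [/\ [/\ forall x y, d x y = 0 <-> x = y,
            forall x y, d x y = d y x
          & forall x y z, d x z <= d x y + d y z],
        forall x y z, d (x + z) (y + z) = d x y,
        forall (x : X) (A : set X), nbhs x A <->
          exists2 e : R, 0 < e & [set y | d x y < e] `<=` A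
      & forall u : nat -> X,
          (forall e : R, 0 < e -> exists N : nat, forall m n : nat,
             (N <= m)%N -> (N <= n)%N -> d (u m) (u n) < e) ->
          exists l : X, u @ \oo --> l].

Definition Frechet_UBP_over
    (R : realType) (K : numFieldType) (F : set_system nat) : Prop :=
  forall X Y : tvsType K, Frechet_space R X ->
  forall T : nat -> {linear X -> Y}, (forall i, continuous (T i)) ->
  pointwise_F_bounded F T -> F_equicontinuous F T.

Definition stationary_Frechet_UBP_over
    (R : realType) (K : numFieldType) (F : set_system nat) : Prop :=
  forall X Y : tvsType K, Frechet_space R X ->
  forall T : nat -> {linear X -> Y}, (forall i, continuous (T i)) ->
  pointwise_F_bounded F T -> F_stationary_equicontinuous F T.

(* The scalar field may be real or complex. *)
Definition Frechet_UBP_filter (R : realType) (F : set_system nat) : Prop :=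
  Frechet_UBP_over R R F /\ Frechet_UBP_over R R[i] F.

Definition stationary_Frechet_UBP_filter
    (R : realType) (F : set_system nat) : Prop :=
  stationary_Frechet_UBP_over R R F /\ stationary_Frechet_UBP_over R R[i] F.

(* Main.v *)
(** Suppose equicontinuity fails for [V]. The P-type hypothesis yields a
    stationary set [B] on which, for each ball [U], [T_i[U]] is contained in [V]
    for only finitely many [i], and rapidity thins [B] to a stationary
    [{i_0 < i_1 < ...}] with points [y_n], where [d 0 (y_n) < 2^-(3n+1)] and
    [T_{i_n} y_n] is not in [V]. Rapidity does not make the gaps [i_{n+1} - i_n]
    large, so an inductive gliding hump is unavailable; instead consider all
    [x = \sum_n a_n 2^n y_n] with digits [a_n < 2^(n+1)]. If the other digits are
    fixed, at most one value of [a_n] makes [2^-n T_{i_n} x] small, and as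
    [\sum_n 2^-(n+1)] stays below 1 on finite index sets, counting gives digits
    that are good for all [n < N]. An ultralimit over [N] of these digits gives
    one [x] with [2^-n T_{i_n} x] bounded away from 0 for all [n], which
    contradicts pointwise [F]-boundedness. *)

Require Import Defs.
From mathcomp Require Import all_boot all_order all_algebra.
From mathcomp Require Import all_classical all_reals all_analysis.
From mathcomp Require Import complex zify lra.

Set Implicit Arguments.
Unset Strict Implicit.
Unset Printing Implicit Defensive.

Import Order.TTheory GRing.Theory Num.Theory.
Import numFieldNormedType.Exports.

Local Open Scope classical_set_scope.
Local Open Scope ring_scope.

(** * Counting digit choices *)

(** A union bound: [P n] holds for at most a fraction 2^-(n+1) of the digit choices, and these
    fractions sum to less than 1 over [n < N]. *)
Lemma exists_avoiding (N : nat) (P : nat -> (nat -> nat) -> Prop) :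
  (forall n c c', P n c -> P n c' ->
     (forall m, m != n -> c m = c' m) -> c n = c' n) ->
  exists2 c : nat -> nat, (forall n, c n < 2 ^ n.+1)%N &
    forall n, (n < N)%N -> ~ P n c.
Proof.
move=> Puniq; pose T := {ffun 'I_N -> 'I_(2 ^ N)}.
(* Digits from position [N] on are set to 0, so two extensions can differ only below [N]. *)
pose ext (c : T) m := oapp (fun i => val (c i)) 0%N (insub m).
have ext_ord c (i : 'I_N) : ext c i = c i by rewrite /ext valK.
pose Om := [set c : T | [forall n, c n < 2 ^ n.+1]%N]%SET.
pose bad n := [set c in Om | `[< P n (ext c) >]]%SET.
(* Changing the [n]-th digit of a bad point to any value [j < 2 ^ n.+1] is
   injective, since the original digit is determined by the others. *)
have card_bad (n : 'I_N) : (#|bad n| * 2 ^ n.+1 <= #|Om|)%N.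
  have le_nN : (2 ^ n.+1 <= 2 ^ N)%N by rewrite leq_exp2l.
  pose upd (u : T * 'I_(2 ^ n.+1)) : T :=
    [ffun m => if m == n then widen_ord le_nN u.2 else u.1 m].
  rewrite -[X in (_ * X)%N]card_ord -cardsT -cardsX.
  rewrite -(card_in_imset (f := upd)).
    apply/subset_leq_card/fintype.subsetP => _ /imsetP[[c j] /setXP[/= + _] ->].
    rewrite !inE => /andP[/forallP cOm _]; apply/forallP => m.
    by rewrite ffunE; case: eqP => [->|_] /=.
  move=> [c j] [c' j'] /setXP[/= + _] /setXP[/= + _] /ffunP eq_upd.
  rewrite !inE => /andP[_ /asboolP Pc] /andP[_ /asboolP Pc'].
  have eq_j : j = j'.
    have := eq_upd n; rewrite !ffunE eqxx => /(congr1 val) /= jj'.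
    exact: val_inj.
  have eq_off m : m != n -> c m = c' m.
    by move=> mn; have := eq_upd m; rewrite !ffunE (negPf mn).
  have eq_at : ext c n = ext c' n.
    apply: Puniq => // m mn; rewrite /ext; case: insubP => //= i _ im.
    by rewrite (eq_off i)// -val_eqE /= im.
  rewrite eq_j; congr pair; apply/ffunP => m.
  have [->|/eq_off//] := eqVneq m n.
  by apply/val_inj; rewrite /= -!ext_ord.
have Om0 : (0 < #|Om|)%N.
  have lt0 : (0 < 2 ^ N)%N by rewrite expn_gt0.
  apply/card_gt0P; exists [ffun=> Ordinal lt0]; rewrite inE; apply/forallP => m.
  by rewrite ffunE /= expn_gt0.
(* The bound (1 - 2^-k) #|Om| on the sum, cleared of denominators. *)
have sum_bad k : (k <= N)%N ->
    ((\sum_(n < k) #|bad n|) * 2 ^ k + #|Om| <= 2 ^ k * #|Om|)%N.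
  elim: k => [_|k IH ltkN]; first by rewrite big_ord0 mul0n mul1n.
  have := card_bad (Ordinal ltkN); have := IH (ltnW ltkN).
  rewrite big_ord_recr /= expnS; lia.
have [c] : exists c, c \in (Om :\: \bigcup_(n < N) bad n)%SET.
  apply/finset.set0Pn; rewrite finset.setD_eq0; apply/negP.
  move=> /subset_leq_card leOm.
  have : (#|(\bigcup_(n < N) bad n)%SET| <= \sum_(n < N) #|bad n|)%N.
    apply: (big_ind2 (fun (A : {set T}) m => #|A| <= m)%N) => //.
      by rewrite cards0.
    move=> A a B b Aa Bb.
    by rewrite (leq_trans (leq_card_setU A B))// leq_add.
  move=> /(leq_trans leOm); have := sum_bad _ (leqnn N).
  have : (0 < 2 ^ N)%N by rewrite expn_gt0.
  nia.
rewrite inE => /andP[/bigcupP cgood]; rewrite inE => /forallP cOm.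
exists (ext c) => [n|n nN Pnc].
  rewrite /ext; case: insubP => [i _ <- //=|_ /=]; exact: expn_gt0.
apply: cgood; exists (Ordinal nN) => //; rewrite !inE; apply/andP; split.
  exact/forallP.
exact/asboolP.
Qed.

(** * Ultrafilters, scalars and star-shaped neighbourhoods *)

Lemma ultra_bounded_constant (G : set_system nat) (f : nat -> nat) (M : nat) :
  UltraFilter G -> G [set N | (f N < M)%N] -> exists v, G [set N | f N = v].
Proof.
move=> GU; elim: M => [G0|M IH GM].
  by have [N] := filter_ex G0.
have [GfM|GfM] := in_ultra_setVsetC [set N | f N = M] GU; first by exists M.
apply: IH; apply: filterS (filterI GM GfM) => N /= [].
by rewrite ltnS leq_eqVlt => /orP[/eqP|].
Qed.

(** Isolating this Archimedean property of the scalars lets the real and complex cases share one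
    proof. *)
Definition half_powers_vanish (K : numFieldType) : Prop :=
  forall t : K, 0 < t -> exists n, forall k, (n <= k)%N -> 2^-1 ^+ k < t.

Lemma half_powers_vanish_real (R : realType) : half_powers_vanish R.
Proof.
move=> e e0; have : (fun k => 2^-1 ^+ k : R) @ \oo --> (0 : R).
  by apply: cvg_expr; rewrite ger0_norm// invf_lt1// ltr1n.
by move=> /cvgr_lt /(_ _ e0) [n _ nP]; exists n => k nk; exact: nP.
Qed.

Lemma half_powers_vanish_complex (R : realType) : half_powers_vanish R[i].
Proof.
move=> [a b]; rewrite ltcE /= => /andP[/eqP-> a0].
have [n nP] := half_powers_vanish_real a0; exists n => k /nP.
have -> : (2^-1 ^+ k : R[i]) = (2^-1 ^+ k)%:C%C.
  by rewrite rmorphXn /= fmorphV /= rmorph_nat.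
by rewrite ltcR.
Qed.

(** A convex basic neighbourhood of 0 contains the segment from 0 to each of its points. *)
Lemma star_shaped_nbhs (K : numFieldType) (Y : tvsType K) (V : set Y) :
  nbhs 0 V -> exists W : set Y, [/\ nbhs 0 W, W `<=` V &
    forall (t : K) y, 0 <= t -> t <= 1 -> W y -> W (t *: y)].
Proof.
move=> nV; have [B Bconvex [Bopen Bbase]] := @locally_convex K Y.
have [W [BW W0] WV] := Bbase 0 _ nV.
exists W; split => // [|t y t0 t1 Wy].
  by apply: open_nbhs_nbhs; split => //; exact: Bopen.
have := Bconvex W (mem_set BW) y 0 (Itv01 t0 t1) (mem_set Wy) (mem_set W0).
by rewrite inE /conv /= scaler0 addr0.
Qed.

(** * Translation-invariant metrics *)

(** The condition inside [Frechet_space], with the metric as a parameter so that several lemmas can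
    share one [d]. *)
Definition Frechet_metric (R : realType) (K : numFieldType) (X : tvsType K)
    (d : X -> X -> R) : Prop :=
  [/\ [/\ forall x y, d x y = 0 <-> x = y,
           forall x y, d x y = d y x
         & forall x y z, d x z <= d x y + d y z],
       forall x y z, d (x + z) (y + z) = d x y,
       forall (x : X) (A : set X), nbhs x A <->
         exists2 e : R, 0 < e & [set y | d x y < e] `<=` A
     & forall u : nat -> X,
         (forall e : R, 0 < e -> exists N : nat, forall m n : nat,
            (N <= m)%N -> (N <= n)%N -> d (u m) (u n) < e) ->
         exists l : X, u @ \oo --> l].

Lemma Frechet_metricE (R : realType) (K : numFieldType) (X : tvsType K)
    (d : X -> X -> R) x y : Frechet_metric d -> d x y = d 0 (y - x).
Proof. by move=> [_ dT _ _]; rewrite -(dT x y (- x)) subrr. Qed.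

Lemma Frechet_metricD (R : realType) (K : numFieldType) (X : tvsType K)
    (d : X -> X -> R) x y : Frechet_metric d ->
  d 0 (x + y) <= d 0 x + d 0 y.
Proof.
move=> dX; have [[_ _ dtri] _ _ _] := dX.
rewrite (le_trans (dtri 0 x _))// (Frechet_metricE x _ dX).
by rewrite addrAC subrr add0r.
Qed.

Lemma Frechet_metricMn (R : realType) (K : numFieldType) (X : tvsType K)
    (d : X -> X -> R) x n : Frechet_metric d ->
  d 0 (x *+ n) <= n%:R * d 0 x.
Proof.
move=> dX; have [[d0 _ _] _ _ _] := dX.
elim: n => [|n IH]; first by rewrite mulr0n mul0r (d0 0 0).2.
rewrite mulrS (le_trans (Frechet_metricD _ _ dX))//.
by rewrite -add1n natrD mulrDl mul1r lerD2l.
Qed.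

(** * Gliding hump by counting and ultralimit *)

Lemma gliding_hump (R : realType) (K : numFieldType) (X Y : tvsType K)
    (d : X -> X -> R) (S : nat -> {linear X -> Y}) (V : set Y) (y : nat -> X) :
  Frechet_metric d ->
  (forall n, continuous (S n)) ->
  nbhs 0 V -> (forall n, ~ V (S n (y n))) ->
  (forall n, d 0 (y n) <= 2^-1 ^+ (3 * n).+1) ->
  exists (x : X) (W : set Y), nbhs 0 W /\
    forall n, ~ W (2^-1 ^+ n *: S n x).
Proof.
move=> dX Scont nV yV dy; have [[d0 dC dtri] _ dnbhs dcomplete] := dX.
(* [V0] allows shrinking by scalars, differences from [V1] will separate two digits, and sums from
   [W] will absorb the passage from a partial sum to the limit. *)
have [V0 [nV0 V0V V0star]] := star_shaped_nbhs nV.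
have [V1 nV1 V1V0] : exists2 V1 : set Y, nbhs 0 V1 &
    forall a b, V1 a -> V1 b -> V0 (a - b).
  have := @sub_continuous Y (0, 0) V0; rewrite /= subrr => /(_ nV0).
  move=> [[A B] /= [nA nB] AB]; exists (A `&` B); first exact: filterI.
  by move=> a b [Aa _] [_ Bb]; apply: (AB (a, b)).
have [W nW WV1] : exists2 W : set Y, nbhs 0 W &
    forall a b, W a -> W b -> V1 (a + b).
  have := @add_continuous Y (0, 0) V1; rewrite /= addr0 => /(_ nV1).
  move=> [[A B] /= [nA nB] AB]; exists (A `&` B); first exact: filterI.
  by move=> a b [Aa _] [_ Bb]; apply: (AB (a, b)).
(* The weight 2^m makes a unit change of digit [m] alter 2^-m S_m x by exactly S_m (y_m). *)
pose z (b : nat -> nat) m := y m *+ (b m * 2 ^ m).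
pose s b N := \sum_(0 <= m < N) z b m.
pose digits (b : nat -> nat) := forall n, (b n < 2 ^ n.+1)%N.
(* Digit and weight cost at most 2^(2m+1), and the bound 2^-(3m+1) on [y m] leaves 2^-m. *)
have dz b m : digits b -> d 0 (z b m) <= 2^-1 ^+ m.
  move=> bM; rewrite (le_trans (Frechet_metricMn _ _ dX))//.
  have le_b : (b m * 2 ^ m)%:R <= 2 ^+ (2 * m).+1 :> R.
    rewrite -natrX ler_nat (leq_trans (leq_mul (ltnW (bM m)) (leqnn _)))//.
    by rewrite -expnD leq_exp2l//; lia.
  rewrite (le_trans (ler_pM _ _ le_b (dy m)))//.
    have := dtri 0 (y m) 0; rewrite (d0 0 0).2// (dC (y m)); lra.
  rewrite (_ : (3 * m).+1 = ((2 * m).+1 + m)%N); last by lia.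
  by rewrite exprD mulrA -exprMn divff// expr1n mul1r.
(* Keeping the subtracted term makes the induction on [N] close. *)
have dtail b k N : digits b -> (k <= N)%N ->
    d 0 (\sum_(k <= m < N) z b m) <= 2 * 2^-1 ^+ k - 2 * 2^-1 ^+ N.
  move=> bM; elim: N => [|N IH].
    by rewrite leqn0 => /eqP->; rewrite big_geq// (d0 0 0).2// subrr.
  rewrite leq_eqVlt => /orP[/eqP->|].
    by rewrite big_geq// (d0 0 0).2// subrr.
  rewrite ltnS => kN; rewrite big_nat_recr//=.
  rewrite (le_trans (Frechet_metricD _ _ dX))//.
  have := IH kN; have := dz _ N bM; rewrite exprS; lra.
have dtail_s b k N : digits b -> (k <= N)%N ->
    d (s b k) (s b N) <= 2 * 2^-1 ^+ k.
  move=> bM kN; rewrite (Frechet_metricE _ _ dX) /s (big_cat_nat _ kN)//=.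
  rewrite addrAC subrr add0r (le_trans (dtail _ _ _ bM kN))// gerBl.
  by rewrite mulr_ge0// exprn_ge0.
have [c cM cgood] : exists2 c : nat -> nat -> nat, forall N, digits (c N) &
    forall N n, (n < N)%N -> ~ V1 (2^-1 ^+ n *: S n (s (c N) N)).
  suff /choice[c cP] : forall N, exists b, digits b /\
      forall n, (n < N)%N -> ~ V1 (2^-1 ^+ n *: S n (s b N)).
    by exists c => N; have [] := cP N.
  move=> N.
  have [|b bM bP] := @exists_avoiding N (fun n b =>
      (n < N)%N /\ V1 (2^-1 ^+ n *: S n (s b N))); last first.
    by exists b; split => // n nN Vn; exact: (bP n).
  suff lt_absurd n b b' : (n < N)%N -> V1 (2^-1 ^+ n *: S n (s b N)) ->
      V1 (2^-1 ^+ n *: S n (s b' N)) -> (forall m, m != n -> b m = b' m) ->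
      ~ (b n < b' n)%N.
    move=> n b b' [nN Vb] [_ Vb'] bb'.
    have := lt_absurd n b b' nN Vb Vb' bb'.
    have := lt_absurd n b' b nN Vb' Vb (fun m mn => esym (bb' m mn)).
    move=> /negP + /negP; rewrite -!leqNgt => ? ?; apply/eqP.
    by rewrite eqn_leq; apply/andP.
  (* Two digits that both land in [V1] put a positive integer multiple of S_n (y_n) in [V0];
     dividing by that integer stays in [V0], contradicting the choice of [y n]. *)
  move=> nN Vb Vb' bb' lt_b; apply: (yV n); apply: V0V.
  have := V1V0 _ _ Vb' Vb.
  have -> : 2^-1 ^+ n *: S n (s b' N) - 2^-1 ^+ n *: S n (s b N) =
      (b' n - b n)%:R *: S n (y n).
    rewrite -scalerBr -linearB /s -sumrB.
    rewrite (bigD1_seq n) ?mem_index_iota ?iota_uniq//= big1 => [|m mn].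
      rewrite addr0 /z -mulrnBr ?leq_mul2r ?(ltnW lt_b) ?orbT//.
      rewrite -mulnBl -(scaler_nat _ (y n)) linearZ /= scalerA.
      rewrite mulrC natrM -mulrA natrX.
      by rewrite -exprMn mulfV ?pnatr_eq0// expr1n mulr1.
    by rewrite /z bb'// subrr.
  have q0 : (0 < (b' n - b n))%N by rewrite subn_gt0.
  move=> /(V0star (b' n - b n)%:R^-1); rewrite scalerA.
  rewrite mulVf ?pnatr_eq0 -?lt0n//.
  by rewrite scale1r; apply; rewrite ?invr_ge0// invf_le1 ?ler1n ?ltr0n.
have [G [GU leG]] := ultraFilterLemma (eventually_filter : ProperFilter \oo).
have /choice[a aG] : forall m, exists v, G [set N | c N m = v].
  move=> m; apply: (ultra_bounded_constant GU (M := (2 ^ m.+1)%N)).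
  by apply: filterS filterT => N _; exact: cM.
have aM : digits a.
  by move=> m; have [N /= <-] := filter_ex (aG m); exact: cM.
have agree k : G [set N | s (c N) k = s a k].
  elim: k => [|k IH].
    by apply: filterS filterT => N _; rewrite /= /s !big_geq.
  apply: filterS (filterI IH (aG k)) => N /= [sk ck].
  by rewrite /s !big_nat_recr//= -!/(s _ _) sk /z ck.
have [l sl] : exists l : X, s a @ \oo --> l.
  apply: (dcomplete (s a)) => e e0.
  have [k0 k0P] := half_powers_vanish_real (divr_gt0 e0 (ltr0Sn R 1)).
  exists k0 => m n mk nk.
  wlog mn : m n mk nk / (m <= n)%N => [hw|].
    by case/orP: (leq_total m n) => mn; [|rewrite dC]; exact: hw.
  rewrite (le_lt_trans (dtail_s _ _ _ aM mn))// mulrC.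
  by rewrite -ltr_pdivlMr//; exact: k0P.
(* If [W] held at [l], then [V1] would hold at a partial sum of some [c N] close to [l], against
   [cgood]. Such an [N] exists because [c N] shares the first [k] digits of [a] for arbitrarily
   large [N]. *)
exists l, W; split => // n Wl.
have /dnbhs[e e0 eW] : nbhs 0 [set x | W (2^-1 ^+ n *: S n x)].
  have := @scale_continuous K Y (2^-1 ^+ n, 0) W; rewrite /= scaler0 => /(_ nW).
  move=> [[A B] /= [nA nB] AB].
  have nSB : nbhs 0 (S n @^-1` B) by apply: Scont; rewrite linear0.
  apply: filterS nSB => x Bx.
  by apply: (AB (_, S n x)); split => //=; exact: (nbhs_singleton nA).
have e40 : 0 < e / 2 by rewrite divr_gt0.
have [k1 _ k1P] : \forall k \near \oo, d l (s a k) < e / 2.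
  have nl : nbhs l [set x | d l x < e / 2] by apply/dnbhs; exists (e / 2).
  exact: sl _ nl.
have [k2 k2P] := half_powers_vanish_real (divr_gt0 e40 (ltr0Sn R 1)).
pose k := maxn k1 k2.
have [N [/= agreeN ltN]] : exists N, s (c N) k = s a k /\ (maxn k n < N)%N.
  have GN : G [set N | (maxn k n < N)%N] by apply: leG; exists (maxn k n).+1.
  by have [N []] := filter_ex (filterI (agree k) GN); exists N.
apply: (cgood N n); first by lia.
rewrite -(subrK l (s (c N) N)) linearD scalerDr; apply: WV1 => //.
apply: eW => /=; rewrite -(Frechet_metricE _ _ dX).
have lt1 := k1P k (leq_maxl _ _); have lt2 := k2P k (leq_maxr _ _).
have le_kN : (k <= N)%N by lia.
have := dtail_s _ k N (cM N) le_kN; rewrite agreeN.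
have := dtri l (s a k) (s (c N) N).
lra.
Qed.

(** * Rapidity against thin sets *)

Lemma finite_nat_bounded (A : set nat) :
  finite_set A -> exists n, forall i, A i -> (i < n)%N.
Proof.
move=> /finite_seqP[s ->]; exists (\max_(i <- s) i).+1 => i /= si.
by rewrite ltnS; apply: leq_bigmax_seq.
Qed.

(** The hump point [x] keeps 2^-n T_{eta n} x outside a fixed neighbourhood, whereas boundedness at
    [x] puts t T_i x inside it for F-most i; these clash once 2^-n < t. *)
Lemma rapid_plus_not_thin (R : realType) (K : numFieldType)
    (F : set_system nat) (X Y : tvsType K) (d : X -> X -> R)
    (T : nat -> {linear X -> Y}) (V : set Y) (B : set nat) :
  half_powers_vanish K ->
  free_filter F -> rapid_plus F ->
  Frechet_metric d ->
  (forall i, continuous (T i)) -> pointwise_F_bounded F T ->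
  nbhs 0 V -> stationary F B ->
  ~ (forall k, finite_set
       (B `&` [set i | T i @` [set x | d 0 x < 2^-1 ^+ k] `<=` V])).
Proof.
move=> archK [FF Ffree] rapid dX Tcont Tbnd nV FB thin.
have /choice[g gP] : forall n, exists N, forall i, B i -> (N <= i)%N ->
    ~ (T i @` [set x | d 0 x < 2^-1 ^+ (3 * n).+1] `<=` V).
  move=> n; have [N NP] := finite_nat_bounded (thin (3 * n).+1).
  exists N => i Bi Ni TV; have := NP i (conj Bi TV); lia.
(* A strictly increasing majorant of [g], as rapidity requires. *)
pose f n := (\sum_(0 <= k < n.+1) (g k).+1)%N.
have fS n : f n.+1 = (f n + (g n.+1).+1)%N by rewrite /f big_nat_recr.
have gf n : (g n <= f n)%N by rewrite /f big_nat_recr//=; lia.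
have f_incr : strictly_increasing f.
  by apply: homo_ltn => [|n]; [exact: ltn_trans|rewrite fS; lia].
have [B' [eta [FB' B'B [_ etaB'] eta_f]]] := rapid B FB f f_incr.
have B'eta n : B' (eta n) by rewrite -etaB'; exists n.
have /choice[y yP] : forall n, exists x,
    d 0 x < 2^-1 ^+ (3 * n).+1 /\ ~ V (T (eta n) x).
  move=> n; apply: contrapT => /forallNP noy.
  apply: (gP n (eta n)); first exact: B'B.
    exact: leq_trans (gf n) (eta_f n).
  move=> _ [x xd <-]; apply: contrapT => nVx; exact: (noy x).
have [x [W [nW xW]]] := @gliding_hump R K X Y d (fun n => T (eta n)) V y
  dX (fun n => Tcont _) nV (fun n => (yP n).2) (fun n => ltW (yP n).1).
have [W' [nW' W'W W'star]] := star_shaped_nbhs nW.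
have [t t0 FE] := Tbnd x W' nW'; have [n0 n0t] := archK t t0.
(* Discarding the first [n0] elements of [B'] leaves only indices [eta n] with 2^-n < t. *)
have Fcofin : F (~` (eta @` `I_n0)).
  by apply: Ffree; rewrite setCK; exact/finite_image/finite_II.
apply: FB'; apply: filterS (filterI FE Fcofin) => i [/= W'i i_n0] B'i.
move: B'i; rewrite -etaB' => -[n _ eta_n].
have n0n : (n0 <= n)%N.
  by rewrite leqNgt; apply/negP => nn0; apply: i_n0; exists n.
apply: (xW n); apply: W'W; rewrite eta_n.
have -> : 2^-1 ^+ n *: T i x = (2^-1 ^+ n / t) *: (t *: T i x).
  by rewrite scalerA divfK// gt_eqF.
apply: W'star => //; first by rewrite divr_ge0 ?exprn_ge0 ?invr_ge0 ?ltW.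
by rewrite ler_pdivrMr// mul1r ltW// n0t.
Qed.

(** * Thin sets from the P-type hypotheses *)

Lemma stationary_Frechet_UBP_overP (R : realType) (K : numFieldType)
    (F : set_system nat) :
  half_powers_vanish K ->
  free_filter F -> rapid_plus F -> weak_P_plus F ->
  stationary_Frechet_UBP_over R K F.
Proof.
move=> archK hF rapid weakP X Y [d dX] T Tcont Tbnd I FI V nV.
have [FF _] := hF; have [_ _ dnbhs _] := (dX : Frechet_metric d).
apply: contrapT => noUJ.
pose U k := [set x | d 0 x < 2^-1 ^+ k].
have subU k : U k.+1 `<=` U k.
  move=> x /= /lt_le_trans; apply.
  by rewrite exprS ler_piMl ?exprn_ge0// invf_le1 ?ler1n.
(* The guard [I i] places the complement of [A k] inside [I], so if [A k] were not in [F] that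
   complement would serve as [J]. *)
pose A k := [set i | I i -> ~ (T i @` U k `<=` V)].
have decrA : decreasing_sets A.
  move=> k i Ai Ii TU; apply: Ai => //.
  by apply: subset_trans TU; exact/image_subset/subU.
have FA k : F (A k).
  apply: contrapT => nFA; apply: noUJ; exists (U k), (~` A k); split.
  - by apply/dnbhs; exists (2^-1 ^+ k) => //; rewrite exprn_gt0.
  - by rewrite /stationary setCK.
  - by move=> i /not_implyP[].
  - by move=> i /not_implyP[_ /contrapT].
have [B [FB BI BA]] := weakP A decrA FA I FI.
apply: (rapid_plus_not_thin archK hF rapid dX Tcont Tbnd nV FB) => k.
apply: sub_finite_set (BA k) => i [Bi TU]; split => // Ai.
by apply: Ai => //; exact: BI.
Qed.

Lemma Frechet_UBP_overP (R : realType) (K : numFieldType)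
    (F : set_system nat) :
  half_powers_vanish K ->
  free_filter F -> rapid_plus F -> P_plus F -> Frechet_UBP_over R K F.
Proof.
move=> archK hF rapid Pplus X Y [d dX] T Tcont Tbnd V nV.
have [FF _] := hF; have [_ _ dnbhs _] := (dX : Frechet_metric d).
apply: contrapT => noU.
pose U k := [set x | d 0 x < 2^-1 ^+ k].
have subU k : U k.+1 `<=` U k.
  move=> x /= /lt_le_trans; apply.
  by rewrite exprS ler_piMl ?exprn_ge0// invf_le1 ?ler1n.
pose A k := [set i | ~ (T i @` U k `<=` V)].
have decrA : decreasing_sets A.
  move=> k i Ai TU; apply: Ai.
  by apply: subset_trans TU; exact/image_subset/subU.
(* Otherwise [U k] would witness equicontinuity for [V]. *)
have FA k : stationary F (A k).
  move=> FTU; apply: noU; exists (U k).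
    by apply/dnbhs; exists (2^-1 ^+ k) => //; rewrite exprn_gt0.
  by apply: filterS FTU => i /contrapT.
have [B [FB BA]] := Pplus A decrA FA.
apply: (rapid_plus_not_thin archK hF rapid dX Tcont Tbnd nV FB) => k.
by apply: sub_finite_set (BA k) => i [Bi TU]; split => // Ai; exact: Ai.
Qed.

Theorem theorem3p1 (R : realType) (F : set_system nat) (hF : free_filter F) :
  (rapid_plus F /\ weak_P_plus F -> stationary_Frechet_UBP_filter R F) /\
  (rapid_plus F /\ P_plus F -> Frechet_UBP_filter R F).
Proof.
split=> -[rapid P]; split.
- exact: (stationary_Frechet_UBP_overP (@half_powers_vanish_real R)).
- exact: (stationary_Frechet_UBP_overP (@half_powers_vanish_complex R)).
- exact: (Frechet_UBP_overP (@half_powers_vanish_real R)).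
- exact: (Frechet_UBP_overP (@half_powers_vanish_complex R)).
Qed.
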